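(* Let $A$ be a commutative unital ring. The following properties are equivalent. (i) The ring $A$ is a good ring. (ii) The ring $A$ has enough homogeneous polynomials. (iii) The ring $A$ has enough homogeneous polynomials in two variables.
   Context: All rings are commutative and unital; $A^\times$ denotes the unit group of $A$ (if $A=\{0\}$ then $A^\times=A$). A point $p=(x_1,\dots,x_n)\in A^n$ is primitive if $x_1A+\dots+x_nA=A$. A primitive point $(a,b)\in A^2$ is a good point if there are an integer $N\ge 1$ and $\lambda\in A$ (both depending on $(a,b)$) with $b^N+\lambda a\in A^\times$. The ring $A$ is a good ring if every primitive point in $A^2$ is a good point. $A$ has enough homogeneous polynomials if for every $n\ge 2$ and every finite nonempty set $\{p_1,\dots,p_k\}$ ($k\ge 1$) of primitive points in $A^n$ there is a homogeneous polynomial $P\in A[X_1,\dots,X_n]$ of degree $\ge 1$ with $P(p_i)\in A^\times$ for all $1\le i\le k$. $A$ has enough homogeneous polynomials in two variables if this property holds for $n=2$. *)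

(* Defs.v *)
From mathcomp Require Import all_boot all_order all_algebra finmap.
From mathcomp Require Import mpoly.

Set Implicit Arguments.
Unset Strict Implicit.
Unset Printing Implicit Defensive.

Import GRing.Theory.

Local Open Scope ring_scope.

(* The zero ring is allowed, so the base ring is a comPzRingType.  The library *)
(* notions GRing.unit and {mpoly A[n]} require a nontrivial ring, hence the    *)
(* definitions of units and of polynomials below.                              *)

Definition is_unit (A : comPzRingType) (a : A) : Prop :=
  exists b : A, a * b = 1.

Definition primitive (A : comPzRingType) (n : nat) (x : 'rV[A]_n) : Prop :=
  forall c : A, exists y : 'rV[A]_n, c = \sum_(i < n) x 0 i * y 0 i.

Definition good_point (A : comPzRingType) (p : 'rV[A]_2) : Prop :=
  primitive p /\
  exists (N : nat) (lambda : A),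
    (1 <= N)%N /\ is_unit (p 0 1 ^+ N + lambda * p 0 0).

Definition good_ring (A : comPzRingType) : Prop :=
  forall p : 'rV[A]_2, primitive p -> good_point p.

(* A polynomial is its finitely supported family of coefficients. *)
Definition mpolynomial (A : comPzRingType) (n : nat) : Type :=
  {fsfun 'X_{1..n} -> A with 0}.

Definition peval (A : comPzRingType) (n : nat) (P : mpolynomial A n)
    (x : 'rV[A]_n) : A :=
  \sum_(m <- finsupp P) P m * \prod_(i < n) x 0 i ^+ m i.

(* The zero polynomial is homogeneous of every degree. *)
Definition homogeneous (A : comPzRingType) (n d : nat) (P : mpolynomial A n) :
    Prop :=
  forall m : 'X_{1..n}, P m <> 0 -> mdeg m = d.

Lemma mpolynomial_mpolyE (A : comNzRingType) (n : nat) (P : mpolynomial A n)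
    (Q : {mpoly A[n]}) :
  (forall m, P m = Q@_m) ->
  (forall x, peval P x = Q.@[fun i => x 0 i]) /\
  (forall d, homogeneous d P <-> Q \is d.-homog).
Proof.
move=> PQ; have supE : finsupp P =i msupp Q.
  by move=> m; rewrite mem_finsupp mcoeff_msupp PQ.
split=> [x | d].
  rewrite mevalE /peval (perm_big (msupp Q)) /=.
    by apply: eq_bigr => m _; rewrite PQ.
  by apply: uniq_perm supE; [exact: fset_uniq | exact: msupp_uniq].
split=> [hP | /dhomogP hQ m].
  by apply/dhomogP => m; rewrite mcoeff_msupp => /eqP; rewrite -PQ => /hP.
by move/eqP; rewrite PQ -mcoeff_msupp => /hQ.
Qed.

Definition enough_homog_in (A : comPzRingType) (n : nat) : Prop :=
  forall S : {fset 'rV[A]_n},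
    S != fset0 -> (forall p, p \in S -> primitive p) ->
    exists (d : nat) (P : mpolynomial A n),
      [/\ (1 <= d)%N, homogeneous d P &
          forall p, p \in S -> is_unit (peval P p)].

Definition enough_homog (A : comPzRingType) : Prop :=
  forall n : nat, (2 <= n)%N -> enough_homog_in A n.

Definition enough_homog_two (A : comPzRingType) : Prop :=
  enough_homog_in A 2.

(* Main.v *)
From HB Require Import structures.
Require Import Defs.
From mathcomp Require Import all_boot all_order all_algebra.
From mathcomp Require Import finmap mpoly ring.

(** (iii) => (i): if P is homogeneous of degree d in two variables and takes
    unit values at (0, 1) and (a, b), then P(a, b) = P(0, 1) b^d modulo a.

    (i) => (ii), by induction on the number of points: let P be homogeneous
    with unit values at p_1, ..., p_k and let q be a further primitive point.
    Modulo the ideal of the values at q of the linear forms vanishing at p_i,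
    q is a unit multiple of p_i, so that P(q) is a unit.  Multiplying over i
    gives a form Q of degree k that vanishes at every p_i, with P(q) and Q(q)
    comaximal.  As A is good, P(q)^N + l Q(q) is a unit for arbitrarily large
    N and some l; then P^N + l Q L^e works, where L is a linear form with
    L(q) = 1 and e makes the sum homogeneous. *)

Set Implicit Arguments.
Unset Strict Implicit.
Unset Printing Implicit Defensive.

Import GRing.Theory.

Local Open Scope ring_scope.

Lemma primitiveP (A : comPzRingType) (n : nat) (x : 'rV[A]_n) :
  primitive x <-> exists y : 'rV[A]_n, \sum_(i < n) x 0 i * y 0 i = 1.
Proof.
split=> [/(_ 1) [y ->] | [y xy1] c]; first by exists y.
exists (c *: y); rewrite -[LHS]mulr1 -xy1 mulr_sumr.
by apply: eq_bigr => i _; rewrite mxE mulrCA.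
Qed.

Lemma is_unitX (A : comPzRingType) (a : A) n : is_unit a -> is_unit (a ^+ n).
Proof. by case=> b ab1; exists (b ^+ n); rewrite -exprMn ab1 expr1n. Qed.

Lemma is_unitMr (A : comPzRingType) (a b : A) : is_unit (a * b) -> is_unit b.
Proof. by case=> c abc1; exists (a * c); rewrite mulrCA mulrA. Qed.

(** A power of the unit [b ^+ N + l * a] is again a unit and is congruent to a power of [b] modulo
    [a], so the exponent can be made as large as desired. *)
Lemma good_ring_unit (A : comPzRingType) (a b c e : A) (M : nat) :
  good_ring A -> a * c + b * e = 1 ->
  exists (N : nat) (l : A), [/\ (1 <= N)%N, (M <= N)%N &
    is_unit (b ^+ N + l * a)].
Proof.
move=> goodA ab1; pose row2 (x y : A) : 'rV[A]_2 := \row_i if i == 0 then x else y.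
have /goodA [_ [N [l [N_gt0]]]] : primitive (row2 a b).
  by apply/primitiveP; exists (row2 c e); rewrite !big_ord_recl big_ord0 !mxE addr0.
rewrite !mxE /= => /(is_unitX M.+1) unitab.
have := subrXX (b ^+ N + l * a) (b ^+ N) M.+1.
set S := \sum_(i < _) _ => eS; exists (N * M.+1)%N, (l * S).
split; rewrite ?muln_gt0 ?N_gt0 //; first by rewrite (leq_trans (leqnSn M)) ?leq_pmull.
suff -> : b ^+ (N * M.+1) + l * S * a = (b ^+ N + l * a) ^+ M.+1 by [].
by apply/eqP; rewrite exprM addrC eq_sym -subr_eq eS addrAC subrr add0r mulrAC.
Qed.

Section Forms.

Variables (A : comNzRingType) (n : nat).
Implicit Types (p q : 'rV[A]_n) (P Q L : {mpoly A[n]}).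

Local Notation "P .@ p" := (meval (fun i => p 0 i) P) (at level 2).

(** Congruence modulo the ideal [J] respects sums and products, hence polynomial evaluation. As a
    mere predicate, [J] may be given by an existential statement. *)
Lemma meval_congr (J : A -> Prop) P (v w : 'I_n -> A) :
  J 0 -> (forall a b, J a -> J b -> J (a + b)) ->
  (forall a b, J a -> J (b * a)) ->
  (forall i, J (v i - w i)) -> J (P.@[v] - P.@[w]).
Proof.
move=> J0 JD JM Jvw.
pose eqJ a b := J (a - b).
have eqJM a b c e : eqJ a b -> eqJ c e -> eqJ (a * c) (b * e).
  rewrite /eqJ => Jab Jce.
  have -> : a * c - b * e = c * (a - b) + b * (c - e) by ring.
  by apply: JD; apply: JM.
have eqJD a b c e : eqJ a b -> eqJ c e -> eqJ (a + c) (b + e).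
  by rewrite /eqJ => Jab Jce; rewrite opprD addrACA; apply: JD.
have eqJxx x : eqJ x x by rewrite /eqJ subrr.
rewrite -/(eqJ _ _) !mevalE; apply: (big_ind2 eqJ (eqJxx 0) eqJD) => m _.
apply: (eqJM _ _ _ _ (eqJxx _)); apply: (big_ind2 eqJ (eqJxx 1) eqJM) => i _.
by elim: (m i) => // k IHk; rewrite !exprS; apply: eqJM.
Qed.

Lemma dhomog_mevalZ d P (u : A) (v : 'I_n -> A) :
  P \is d.-homog -> P.@[fun i => u * v i] = u ^+ d * P.@[v].
Proof.
move=> /dhomogP hP; rewrite !mevalE mulr_sumr; apply: eq_big_seq => m /hP <-.
rewrite mulrCA /= mdegE -prodrXr -big_split /=; congr (_ * _).
by apply: eq_bigr => i _; rewrite exprMn.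
Qed.

Lemma primitive_form p :
  primitive p -> exists2 L, L \is 1.-homog & L.@p = 1.
Proof.
case/primitiveP=> y py1; exists (\sum_i y 0 i *: 'X_i).
  by apply: rpred_sum => i _; rewrite rpredZ // dhomogX /= mdeg1.
rewrite raddf_sum -py1; apply: eq_bigr => i _ /=.
by rewrite mevalZ mevalXU mulrC.
Qed.

(** The values at [q] of linear forms vanishing at [p] form an ideal [J], modulo which [q] is [Y.@q]
    times [p]. Comparing [P] with [Z ^+ d], whose value at [q] is 1, shows that [P.@q] is invertible
    modulo [J]. *)
Lemma separating_form d P p q :
  P \is d.-homog -> primitive p -> primitive q -> is_unit P.@p ->
  exists L c, [/\ L \is 1.-homog, L.@p = 0 & L.@q = 1 - c * P.@q].
Proof.
move=> hP /primitive_form [Y hY Yp] /primitive_form [Z hZ Zq] [w Pw].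
pose J c := exists L, [/\ L \is 1.-homog, L.@p = 0 & L.@q = c].
have J0 : J 0 by exists 0; rewrite !meval0 rpred0.
have JD a b : J a -> J b -> J (a + b).
  move=> [L [hL Lp La]] [K [hK Kp Kb]]; exists (L + K).
  by rewrite !mevalD rpredD // Lp Kp La Kb addr0.
have JM a b : J a -> J (b * a).
  move=> [L [hL Lp La]]; exists (b *: L).
  by rewrite !mevalZ rpredZ // Lp La mulr0.
(* The form ['X_i - p 0 i *: Y] vanishes at [p] because [Y.@p = 1]. *)
have qup i : J (q 0 i - Y.@q * p 0 i).
  exists ('X_i - p 0 i *: Y).
  rewrite !mevalB !mevalZ !mevalXU Yp mulr1 subrr mulrC; split=> //.
  by rewrite rpredB ?rpredZ // dhomogX /= mdeg1.
have congr e R : R \is e.-homog -> J (R.@q - Y.@q ^+ e * R.@p).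
  by move=> hR; rewrite -dhomog_mevalZ //; apply: meval_congr.
have hZd : Z ^+ d \is d.-homog by rewrite -{2}[d]mul1n; apply: dhomogMn.
(* Modulo [J], 1 is [Y.@q ^+ d * Z.@p ^+ d] and [P.@q] is [Y.@q ^+ d * P.@p]. Since [P.@p * w = 1],
   subtracting [w * Z.@p ^+ d] times the second congruence cancels [Y.@q ^+ d]. *)
have := JD _ _ (congr _ _ hZd) (JM _ (- (w * Z.@p ^+ d)) (congr _ _ hP)).
rewrite !rmorphXn /= Zq expr1n => JL.
suff eL : 1 - Y.@q ^+ d * Z.@p ^+ d +
    - (w * Z.@p ^+ d) * (P.@q - Y.@q ^+ d * P.@p)
    = 1 - (w * Z.@p ^+ d) * P.@q.
  by move: JL; rewrite eL => -[L hL]; exists L, (w * Z.@p ^+ d).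
transitivity (1 - Y.@q ^+ d * Z.@p ^+ d - w * Z.@p ^+ d * P.@q
  + Y.@q ^+ d * Z.@p ^+ d * (P.@p * w)); first by ring.
by rewrite Pw; ring.
Qed.

Lemma separating_product d P q (s : seq 'rV[A]_n) :
  P \is d.-homog -> primitive q ->
  (forall p, p \in s -> primitive p /\ is_unit P.@p) ->
  exists Q c, [/\ Q \is (size s).-homog, forall p, p \in s -> Q.@p = 0 &
    Q.@q = 1 - c * P.@q].
Proof.
move=> hP q_prim; elim: s => [|p s IHs] s_unit.
  by exists 1, 0; rewrite rmorph1 mul0r subr0 dhomog1.
have [x xs | Q [c [hQ Qs Qq]]] := IHs; first by apply: s_unit; rewrite inE xs orbT.
have [p_prim Pp] := s_unit p (mem_head _ _).
have [L [e [hL Lp Lq]]] := separating_form hP p_prim q_prim Pp.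
(* With x = [P.@q]: (1 - e x)(1 - c x) = 1 - (e + c - e c x) x. *)
exists (L * Q), (e + c - e * c * P.@q); split.
- exact: (dhomogM hL hQ).
- move=> x; rewrite inE mevalM => /predU1P[-> | /Qs ->]; last by rewrite mulr0.
  by rewrite Lp mul0r.
- by rewrite mevalM Lq Qq; ring.
Qed.

Lemma good_ring_form (s : seq 'rV[A]_n) :
  good_ring A -> (forall p, p \in s -> primitive p) ->
  exists d P, [/\ (1 <= d)%N, P \is d.-homog &
    forall p, p \in s -> is_unit P.@p].
Proof.
move=> goodA; elim: s => [|q s IHs] s_prim.
  by exists 1, 0; rewrite rpred0.
have s_prim' p : p \in s -> primitive p by move=> ps; apply: s_prim; rewrite inE ps orbT.
have q_prim := s_prim q (mem_head _ _).
have [d [P [d_gt0 hP Ps]]] := IHs s_prim'.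
have [|Q [c [hQ Qs Qq]]] := separating_product hP q_prim (s := s).
  by move=> p ps; split; [exact: s_prim' | exact: Ps].
have [L hL Lq] := primitive_form q_prim.
have PQ1 : Q.@q * 1 + P.@q * c = 1 by rewrite Qq; ring.
have [N [l [N_gt0 sN unitN]]] := good_ring_unit (size s) goodA PQ1.
have sdN : (size s <= d * N)%N by rewrite (leq_trans sN) // leq_pmull.
(* As [size s <= d * N], the truncated subtraction is exact and both terms have degree [d * N]. On
   [s] only [P ^+ N] survives. *)
exists (d * N)%N, (P ^+ N + l *: (Q * L ^+ (d * N - size s))); split.
- by rewrite muln_gt0 d_gt0.
- rewrite rpredD ?dhomogMn // rpredZ // -{2}(subnKC sdN).
  by apply: dhomogM => //; rewrite -{2}[(_ - _)%N]mul1n; apply: dhomogMn.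
- move=> p; rewrite inE mevalD mevalZ mevalM !rmorphXn /= => /predU1P[-> | ps].
    by rewrite Lq expr1n mulr1.
  by rewrite Qs // mul0r mulr0 addr0; apply/is_unitX/Ps.
Qed.

End Forms.

Lemma good_ring_enough_homog (A : comPzRingType) : good_ring A -> enough_homog A.
Proof.
(* In the zero ring every element is a unit, so the zero polynomial serves; otherwise [A] is
   repackaged as a nonzero ring [B] to work in [{mpoly B[n]}]. *)
move=> goodA n _ S _ S_prim; have [A0 | A1] := eqVneq (1 : A) 0.
  exists 1%N, [fsfun]; split=> // [m | p _]; first by rewrite fsfunE.
  by exists 0; rewrite mulr0 A0.
pose B : comNzRingType := HB.pack (GRing.ComPzRing.sort A) (GRing.ComPzRing.class A)
  (GRing.PzSemiRing_isNonZero.Build A A1).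
have [d [P [d_gt0 hP PS]]] := @good_ring_form B n S goodA S_prim.
pose Q : mpolynomial B n := [fsfun m in seq_fset tt (msupp P) => P@_m].
have QP m : Q m = P@_m.
  by rewrite fsfunE seq_fsetE; case: ifPn => // /memN_msupp_eq0.
have [evQ homQ] := mpolynomial_mpolyE QP.
exists d, Q; split=> //; first exact/homQ.
by move=> p /PS; rewrite -evQ.
Qed.

(** Monomials containing the first variable vanish at [e] and give multiples of [p 0 0] at [p]; by
    homogeneity only the [d]-th power of the second variable is left. *)
Lemma peval2_mod (A : comPzRingType) (d : nat) (P : mpolynomial A 2)
    (p e : 'rV[A]_2) :
  homogeneous d P -> e 0 0 = 0 -> e 0 1 = 1 ->
  exists l, peval P p = peval P e * p 0 1 ^+ d + l * p 0 0.
Proof.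
move=> hP e0 e1; rewrite /peval mulr_suml.
apply: (big_rec2 (fun x y => exists l, x = y + l * p 0 0)).
  by exists 0; rewrite mul0r addr0.
move=> m x y _ [l ->].
have [-> | /eqP/hP] := eqVneq (P m) 0.
  by exists l; rewrite !mul0r !add0r.
rewrite mdegE !big_ord_recl !big_ord0 /= addn0 !mulr1.
have -> : lift ord0 ord0 = 1 :> 'I_2 by apply/val_inj.
rewrite e0 e1 expr1n mulr1.
case: (m ord0) => [|k] md.
  by exists l; rewrite -md !expr0 mul1r mulr1 addrA.
exists (P m * p 0 0 ^+ k * p 0 1 ^+ m 1 + l).
by rewrite exprS expr0n /=; ring.
Qed.

Lemma enough_homog_two_good_ring (A : comPzRingType) :
  enough_homog_two A -> good_ring A.
Proof.
move=> homA p p_prim; split=> //.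
pose e : 'rV[A]_2 := \row_i (i == 1)%:R.
have e_prim : primitive e.
  apply/primitiveP; exists e.
  by rewrite !big_ord_recl big_ord0 !mxE /= mul0r mulr1 add0r addr0.
have [| x | d [P [d_gt0 hP Pu]]] := homA [fset e; p]%fset.
- by apply/fset0Pn; exists e; rewrite !inE eqxx.
- by rewrite !inE => /orP[] /eqP ->.
have [||l ePp] := peval2_mod p (e := e) hP; rewrite ?mxE //.
have [|c Pec] := Pu e; first by rewrite !inE eqxx.
have : is_unit (peval P p) by apply: Pu; rewrite !inE eqxx orbT.
(* Here [c] is the inverse of [peval P e], which can therefore be factored out. *)
have -> : peval P p = peval P e * (p 0 1 ^+ d + c * l * p 0 0).
  by rewrite ePp mulrDr !mulrA Pec mul1r.
by move/is_unitMr=> u; exists d, (c * l).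
Qed.

Theorem theorem2p1 (A : comPzRingType) :
  (good_ring A <-> enough_homog A) /\ (enough_homog A <-> enough_homog_two A).
Proof.
have h12 := @good_ring_enough_homog A.
have h31 := @enough_homog_two_good_ring A.
have h23 : enough_homog A -> enough_homog_two A by move=> homA; apply: homA.
by split; split; auto.
Qed.
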